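(* Suppose $d\ge 2$ and $n\ge 0$ are arbitrary integers. (a) We have $$ \mathcal{E}_{dn}^{(d)}\equiv 1 \pmod 2. $$ (b) We have $$ \mathcal{E}_{dn}^{(d)}\equiv -1+\sum_{k=1}^{n-1}\binom{dn}{dk}\pmod 3. $$
   Context: For an integer $d\ge 2$, the generalized Euler numbers $\mathcal{E}_n^{(d)}$, $n\ge 0$, are defined by the exponential generating function $$ \sum_{n\ge 0}\mathcal{E}_n^{(d)}\frac{x^n}{n!}=\frac{1}{1+x^d/d!+x^{2d}/(2d)!+\cdots}, $$ i.e. $\mathcal{E}_n^{(d)}$ is $n!$ times the coefficient of $x^n$ in the multiplicative inverse of the formal power series $\sum_{k\ge0}x^{dk}/(dk)!$. These numbers are integers.
   Formalization: Part (b) is stated only for n ≥ 1: at n = 0 the sum is empty and the printed congruence would read 1 ≡ -1 (mod 3), which is false; part (a) is kept for all n ≥ 0. *)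

(* Defs.v *)
From mathcomp Require Import all_boot all_order all_algebra.

Set Implicit Arguments.
Unset Strict Implicit.
Unset Printing Implicit Defensive.

Import Order.TTheory GRing.Theory Num.Theory.
Local Open Scope ring_scope.

(* A formal power series \sum_n a_n x^n is represented by its coefficient
   sequence a : nat -> F. *)

Definition fps_mul (F : fieldType) (a b : nat -> F) (n : nat) : F :=
  \sum_(k < n.+1) a (n - k)%N * b k.

Definition fps_one (F : fieldType) (n : nat) : F := (n == 0%N)%:R.

(* The coefficients 0, ..., n-1 of the inverse of a, obtained by solving
   fps_mul a b = fps_one for the successive b_m. *)
Fixpoint fps_inv_seq (F : fieldType) (a : nat -> F) (n : nat) : seq F :=
  if n is m.+1 then
    let s := fps_inv_seq a m in
    rcons s ((a 0%N)^-1 * (fps_one F m - \sum_(k < m) a (m - k)%N * s`_k))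
  else [::].

Definition fps_inv (F : fieldType) (a : nat -> F) (n : nat) : F :=
  (fps_inv_seq a n.+1)`_n.

Lemma size_fps_inv_seq (F : fieldType) (a : nat -> F) n :
  size (fps_inv_seq a n) = n.
Proof. by elim: n => //= n IHn; rewrite size_rcons IHn. Qed.

Lemma nth_fps_inv_seq (F : fieldType) (a : nat -> F) n k :
  (k < n)%N -> (fps_inv_seq a n)`_k = fps_inv a k.
Proof.
elim: n => // n IHn; rewrite ltnS leq_eqVlt => /orP[/eqP-> //|lt_kn].
by rewrite /= nth_rcons size_fps_inv_seq lt_kn IHn.
Qed.

Lemma fps_invE (F : fieldType) (a : nat -> F) n :
  fps_inv a n =
    (a 0%N)^-1 * (fps_one F n - \sum_(k < n) a (n - k)%N * fps_inv a k).
Proof.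
rewrite {1}/fps_inv /= nth_rcons size_fps_inv_seq ltnn eqxx.
by congr (_ * (_ - _)); apply: eq_bigr => k _; rewrite nth_fps_inv_seq.
Qed.

Lemma fps_mulV (F : fieldType) (a : nat -> F) :
  a 0%N != 0 -> fps_mul a (fps_inv a) =1 fps_one F.
Proof.
move=> a0_neq0 n; rewrite /fps_mul big_ord_recr /= subnn [fps_inv a n]fps_invE.
by rewrite mulVKf // addrC subrK.
Qed.

(* \sum_(k >= 0) x^(d k) / (d k)!, for d > 0 *)
Definition lacunary_exp (d n : nat) : rat :=
  if (d %| n)%N then (n`!)%:R^-1 else 0.

Definition gen_euler_rat (d n : nat) : rat :=
  (n`!)%:R * fps_inv (lacunary_exp d) n.

(* Taking the numerator only changes the type: see gen_euler_ratE. *)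
Definition gen_euler (d n : nat) : int := numq (gen_euler_rat d n).

Lemma gen_euler_rat_int (d n : nat) : gen_euler_rat d n \is a Num.int.
Proof.
have [m] := ubnP n; elim: m n => // m IHm n; rewrite ltnS => le_nm.
have fact_neq0 k : (k`!)%:R != 0 :> rat by rewrite pnatr_eq0 -lt0n fact_gt0.
rewrite /gen_euler_rat fps_invE {1}/lacunary_exp dvdn0 fact0 invr1 mul1r mulrBr.
apply: rpredB; first by rewrite rpredM ?rpred_nat.
rewrite mulr_sumr; apply: rpred_sum => k _.
rewrite /lacunary_exp; case: ifP => _; last by rewrite mul0r mulr0 rpred0.
have lt_kn := ltn_ord k.
rewrite (_ : _ * _ = ('C(n, k))%:R * gen_euler_rat d k); last first.
  rewrite /gen_euler_rat -(bin_fact (ltnW lt_kn)) !natrM -!mulrA.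
  by congr (_ * (_ * _)); rewrite mulVKf.
by rewrite rpredM ?rpred_nat // IHm // (leq_trans lt_kn).
Qed.

Lemma gen_euler_ratE (d n : nat) : (gen_euler d n)%:~R = gen_euler_rat d n.
Proof.
by rewrite /gen_euler; have /intrP[z ->] := gen_euler_rat_int d n; rewrite numq_int.
Qed.

(* Main.v *)
Require Import Defs.
From mathcomp Require Import all_boot all_order all_algebra.
From mathcomp Require Import ring.

(** Let f = \sum_k x^(dk)/(dk)! and let 1/f be its inverse, so that the
    generalized Euler numbers are the exponential coefficients of 1/f.  Say
    that a series is Hurwitz when n! times its n-th coefficient is an integer
    for all n; Hurwitz series are closed under product, because binomial
    coefficients are integers, and under derivation, because derivation
    shifts the sequence of exponential coefficients.

    The key point is that (f^p)' = p * (f^(p-1) * f'): since f^(p-1) * f' is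
    Hurwitz, every exponential coefficient of f^p of positive index is a
    multiple of p ([hurwitz_exp_dvd]).  As f(0) = 1 this says f^p = 1 + p * g
    with g Hurwitz, and multiplication by 1/f gives
      f^(p-1) = 1/f + p * (g/f),
    with g/f Hurwitz.  So the generalized Euler numbers are congruent modulo p
    to the exponential coefficients of f^(p-1) ([gen_euler_mod]).  At index
    d * n these are 1 for p = 2, and \sum_(0 <= k <= n) 'C(dn, dk) for p = 3
    ([lacunary_exp_sqr]); in the latter case the two extreme terms contribute
    2 = -1 modulo 3 when n > 0.

    Since a coefficient of a product only depends on the coefficients of lower
    or equal index of its factors, the argument is carried out in the ring
    {poly rat}, with series truncated above the index of interest. *)

Set Implicit Arguments.
Unset Strict Implicit.
Unset Printing Implicit Defensive.

Import Order.TTheory GRing.Theory Num.Theory.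
Local Open Scope ring_scope.

Lemma factr_neq0 n : (n`!)%:R != 0 :> rat.
Proof. by rewrite pnatr_eq0 -lt0n fact_gt0. Qed.

Definition hurwitz (P : {poly rat}) :=
  forall n, (n`!)%:R * P`_n \is a Num.int.

Lemma hurwitz1 : hurwitz 1.
Proof. by move=> n; rewrite coef1 rpredM ?rpred_nat. Qed.

(** The exponential coefficients of a product are the binomial convolution of
    those of the factors. *)
Lemma hurwitzM P Q : hurwitz P -> hurwitz Q -> hurwitz (P * Q).
Proof.
move=> hP hQ n; rewrite coefM mulr_sumr; apply: rpred_sum => i _.
rewrite -(bin_fact (ltn_ord i : (i <= n)%N)) !natrM -mulrA rpredM ?rpred_nat //.
by rewrite mulrACA rpredM.
Qed.

Lemma hurwitzX P k : hurwitz P -> hurwitz (P ^+ k).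
Proof.
move=> hP; elim: k => [|k IHk]; first exact: hurwitz1.
by rewrite exprS; apply: hurwitzM.
Qed.

Lemma hurwitz_deriv P : hurwitz P -> hurwitz P^`().
Proof.
move=> hP n; rewrite coef_deriv mulrnAr -mulrnAl -[_ *+ _]mulr_natl -natrM.
exact: hP n.+1.
Qed.

(** The n-th exponential coefficient of P ^+ p is the one of index n - 1 of its
    derivative p * (P ^+ p.-1 * P'), hence p times an integer. *)
Lemma hurwitz_exp_dvd P p n : hurwitz P ->
  exists z : int, (n.+1`!)%:R * (P ^+ p)`_n.+1 = p%:R * z%:~R.
Proof.
move=> hP.
have /intrP[z hz] := hurwitzM (hurwitz_deriv hP) (hurwitzX p.-1 hP) n.
exists z; rewrite -hz mulrCA [p%:R * _]mulr_natl -coefMn -deriv_exp coef_deriv.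
by rewrite -[_ *+ n.+1]mulr_natl mulrA -natrM mulnC -factS.
Qed.

(** Dividing P ^+ p - 1 by p keeps it Hurwitz: this is the series g such that
    f^p = 1 + p * g. *)
Lemma hurwitz_exp_quot P p : (0 < p)%N -> hurwitz P -> P`_0 = 1 ->
  hurwitz (p%:R^-1 *: (P ^+ p - 1)).
Proof.
move=> p_gt0 hP P0 [|n]; rewrite coefZ coefB coef1.
  by rewrite -horner_coef0 horner_exp horner_coef0 P0 expr1n subrr !mulr0.
have [z hz] := hurwitz_exp_dvd p n hP.
by rewrite subr0 mulrCA hz mulKf ?rpred_int // pnatr_eq0 -lt0n.
Qed.

Definition lacunary_poly d m : {poly rat} := \poly_(i < m.+1) lacunary_exp d i.

Lemma hurwitz_lacunary d m : hurwitz (lacunary_poly d m).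
Proof.
move=> n; rewrite coef_poly; case: ifP => _; last by rewrite mulr0.
rewrite /lacunary_exp; case: ifP => _; last by rewrite mulr0.
by rewrite divff ?factr_neq0.
Qed.

(** Modulo p, the inverse of f has the same exponential coefficients as
    f^(p-1), here with p = q + 1. *)
Lemma gen_euler_mod d q m : exists z : int,
  gen_euler_rat d m - (m`!)%:R * (lacunary_poly d m ^+ q)`_m =
    q.+1%:R * z%:~R.
Proof.
set F := lacunary_poly d m.
pose E := \poly_(i < m.+1) fps_inv (lacunary_exp d) i.
have lac0 : lacunary_exp d 0 = 1 by rewrite /lacunary_exp dvdn0 fact0 invr1.
have hF : hurwitz F := hurwitz_lacunary d m.
have F0 : F`_0 = 1 by rewrite coef_poly.
have hE : hurwitz E.
  move=> n; rewrite coef_poly; case: ifP => _; last by rewrite mulr0.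
  exact: gen_euler_rat_int.
have FE i : (i <= m)%N -> (E * F)`_i = (i == 0%N)%:R.
  move=> le_im; rewrite -[RHS](@fps_mulV _ (lacunary_exp d)) ?lac0 ?oner_eq0 //.
  rewrite coefM; apply: eq_bigr => j _; rewrite mulrC !coef_poly !ltnS.
  by rewrite (leq_trans (leq_subr _ _)) // (leq_trans _ le_im) // -ltnS.
(* The truncated product E * F is 1 up to index m, so the junk above m does
   not reach the coefficient of index m of (E * F) * F ^+ q. *)
have EFq : (E * F ^+ q.+1)`_m = (F ^+ q)`_m.
  rewrite exprS mulrA coefM (bigD1 ord0) //= FE // mul1r subn0 big1 ?addr0 //.
  move=> i; rewrite -val_eqE /= => /negPf i_neq0.
  by rewrite FE ?(ltnSE (ltn_ord i)) // i_neq0 mul0r.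
pose G := q.+1%:R^-1 *: (F ^+ q.+1 - 1).
have hG : hurwitz G by apply: hurwitz_exp_quot.
have defFq : F ^+ q.+1 = 1 + q.+1%:R *: G.
  by rewrite scalerA divff ?pnatr_eq0 // scale1r addrC subrK.
have /intrP[z hz] := hurwitzM hE hG m; exists (- z).
rewrite -EFq defFq mulrDr mulr1 -scalerAr coefD coefZ mulrDr.
rewrite {2}/E coef_poly ltnSn opprD addrA subrr add0r.
by rewrite mulrCA hz rmorphN mulrN.
Qed.

Lemma lacunary_exp_coef d n : (d %| n)%N ->
  (n`!)%:R * (lacunary_poly d n)`_n = 1.
Proof.
by move=> dvd_dn; rewrite coef_poly ltnSn /lacunary_exp dvd_dn divff ?factr_neq0.
Qed.

(** The multiples of d in [0, d * n] are the d * k for 0 <= k <= n; the inverse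
    of the reindexing k |-> d * k is i |-> i %/ d. *)
Lemma big_dvdn_mul (R : nmodType) d n (G : nat -> R) : (0 < d)%N ->
  \sum_(i < (d * n).+1 | (d %| i)%N) G i = \sum_(k < n.+1) G (d * k)%N.
Proof.
move=> d_gt0.
have lt_mul (k : 'I_n.+1) : (d * k < (d * n).+1)%N.
  by rewrite ltnS leq_mul2l -ltnS ltn_ord orbT.
rewrite (reindex_onto (fun k : 'I_n.+1 => inord (d * k) : 'I_(d * n).+1)
                      (fun i => inord (i %/ d))) /=; last first.
  move=> i dvd_di; have lt_div : (i %/ d < n.+1)%N.
    by rewrite ltnS leq_divLR // (mulnC n) (ltnSE (ltn_ord i)).
  by rewrite (inordK lt_div) (mulnC d (i %/ d)%N) divnK // inord_val.
apply: eq_big => k; last by rewrite inordK.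
rewrite inordK // dvdn_mulr //=; apply/eqP.
by rewrite mulKn // inord_val.
Qed.

(** Since d divides d * n, it divides i iff it divides both i and d * n - i, so
    the only surviving terms of the square at index d * n are the
    (d * n)! / (i! * (d * n - i)!) with i a multiple of d. *)
Lemma lacunary_exp_sqr d n : (0 < d)%N ->
  ((d * n)`!)%:R * (lacunary_poly d (d * n) ^+ 2)`_(d * n) =
    (\sum_(k < n.+1) 'C(d * n, d * k))%N%:R.
Proof.
move=> d_gt0; rewrite natr_sum.
rewrite -(big_dvdn_mul n (fun i => 'C(d * n, i)%:R : rat) d_gt0).
rewrite expr2 coefM mulr_sumr [RHS]big_mkcond; apply: eq_bigr => i _.
have le_i : (i <= d * n)%N by rewrite -ltnS.
rewrite !coef_poly ltn_ord ltnS leq_subr /lacunary_exp.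
case: ifP => dvd_di; last by rewrite mul0r mulr0.
rewrite dvdn_sub ?dvdn_mulr // -(bin_fact le_i) -invfM -natrM natrM mulfK //.
by rewrite natrM mulf_neq0 ?factr_neq0.
Qed.

Theorem theorem4p1 (d n : nat) (hd : (2 <= d)%N) :
  (gen_euler d (d * n) = 1 %[mod 2])%Z /\
  ((0 < n)%N ->
   (gen_euler d (d * n)
      = -1 + (\sum_(1 <= k < n) 'C(d * n, d * k))%N%:Z %[mod 3])%Z).
Proof.
split=> [|n_gt0]; apply/eqP; rewrite eqz_mod_dvd; apply/dvdzP.
  have [z hz] := gen_euler_mod d 1 (d * n); exists z.
  apply: (@intr_inj rat); rewrite mulrC intrM -hz.
  by rewrite intrB gen_euler_ratE expr1 lacunary_exp_coef ?dvdn_mulr.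
have [z] := gen_euler_mod d 2 (d * n).
(* The terms k = 0 and k = n of the full sum contribute 1 + 1 = -1 + 3: this
   accounts for the + 1 in the quotient by 3. *)
rewrite lacunary_exp_sqr ?(ltnW hd) // => hz; exists (z + 1).
apply: (@intr_inj rat); rewrite [RHS]intrM [(z + 1)%:~R]intrD mulrDl.
rewrite [z%:~R * _]mulrC -hz intrB gen_euler_ratE intrD.
rewrite -(big_mkord xpredT (fun k => 'C(d * n, d * k))) big_nat_recr //=.
rewrite [in RHS]big_ltn // muln0 bin0 binn !natrD.
set S := (\sum_(1 <= k < n) _)%N; rewrite -[S%:Z%:~R]/(S%:R : rat).
by ring.
Qed.
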